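(* Let $d$, $n$, $a$ be positive integers with $a < \frac{d+3}{2}$. Then $$h_d^{(a)}(n) \leq \ell_d^{(a)}(n).$$
   Context: A partition $\pi$ is a finite nonempty nonincreasing sequence of positive integers, called its parts. Its perimeter is (largest part of $\pi$) $+$ (number of parts of $\pi$) $-\,1$. A partition is $d$-distinct if any two consecutive parts $\pi_i\ge \pi_{i+1}$ satisfy $\pi_i-\pi_{i+1}\geq d$. For positive integers $n,a,d$: - $h_d^{(a)}(n)$ is the number of partitions with perimeter $n$ whose parts are $d$-distinct and all $\geq a$; - $\ell_d^{(a)}(n)$ is the number of partitions with perimeter $n$ all of whose parts are congruent to $a$ or $-a$ modulo $d+3$. *)

(* Defs.v *)
From mathcomp Require Import all_boot.

Set Implicit Arguments.
Unset Strict Implicit.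
Unset Printing Implicit Defensive.

(* A partition is the sequence of its parts, in nonincreasing order. *)
Definition is_partition (s : seq nat) : bool :=
  [&& s != [::], all (fun x => 0 < x) s & sorted geq s].

Definition perimeter (s : seq nat) : nat := \max_(x <- s) x + size s - 1.

Definition distinct_by (d : nat) (s : seq nat) : bool :=
  sorted (fun x y => y + d <= x) s.

Definition parts_ge (a : nat) (s : seq nat) : bool := all (fun x => a <= x) s.

(* x = - a modulo m is written m %| x + a, to stay within nat. *)
Definition parts_pm_mod (a m : nat) (s : seq nat) : bool :=
  all (fun x => (x == a %[mod m]) || (m %| x + a)) s.

(* A partition of perimeter n has at most n parts, each at most n, so it is
   the image of exactly one bounded sequence in n.-bseq 'I_n.+1
   (lemmas parts_inj and perimeter_bseq). *)
Definition parts (n : nat) (p : n.-bseq 'I_n.+1) : seq nat :=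
  [seq val i | i <- p].

Definition num_perimeter (P : pred (seq nat)) (n : nat) : nat :=
  #|[set p : n.-bseq 'I_n.+1 |
      [&& is_partition (parts p), perimeter (parts p) == n & P (parts p)]]|.

Definition h (d a n : nat) : nat :=
  num_perimeter (fun s => distinct_by d s && parts_ge a s) n.

Definition l (d a n : nat) : nat :=
  num_perimeter (parts_pm_mod a (d + 3)) n.

Lemma parts_inj n : injective (@parts n).
Proof. by move=> p q /(inj_map val_inj) /val_inj. Qed.

Lemma perimeter_bseq n (s : seq nat) :
  is_partition s -> perimeter s = n -> exists p : n.-bseq 'I_n.+1, parts p = s.
Proof.
case/and3P=> s0 spos _ peri.
have maxs x : x \in s -> x <= \max_(y <- s) y by move=> xs; exact: leq_bigmax_seq.
have s_gt0 : 0 < size s by rewrite lt0n size_eq0.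
have max_gt0 : 0 < \max_(y <- s) y.
  case: s s0 spos maxs {peri s_gt0} => // x s _ /= /andP[x0 _] maxs.
  by apply: leq_trans x0 (maxs _ _); rewrite mem_head.
have max_le : \max_(y <- s) y <= n by rewrite -peri /perimeter -addnBA // leq_addr.
have size_le : size s <= n by rewrite -peri /perimeter addnC -addnBA // leq_addr.
have szi : size [seq (inord x : 'I_n.+1) | x <- s] <= n by rewrite size_map.
exists (Bseq szi); rewrite /parts /= -map_comp -[RHS]map_id.
apply/eq_in_map => x xs /=; rewrite inordK // ltnS.
exact: leq_trans (maxs _ xs) max_le.
Qed.

(* Main.v *)
Require Import Defs.
From mathcomp Require Import all_boot.
From mathcomp Require Import zify.

(** Let [p 0 < p 1 < ...] be the numbers congruent to [a] or [-a] modulo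
    [d + 3], starting with [a]. A [d]-distinct partition [s] with parts [>= a]
    and [j + 1] parts is determined by its slacks, that is the smallest part
    minus [a] and the consecutive differences minus [d]. Take the slacks as
    multiplicities of [p 0, ..., p j], and give [p j] the extra multiplicity
    [a + (d + 1) * j - p j + 1]; this is positive because
    [p j <= a + (d + 1) * j]. The result has largest part [p j] and the same
    perimeter as [s], and [s] is recovered from it. *)

Lemma num_perimeter_leq (P Q : pred (seq nat)) (f : seq nat -> seq nat) n :
  {in [pred s | is_partition s && P s], forall s,
     [/\ is_partition (f s), perimeter (f s) = perimeter s & Q (f s)]} ->
  {in [pred s | is_partition s && P s] &, injective f} ->
  num_perimeter P n <= num_perimeter Q n.
Proof.
move=> fP f_inj; rewrite /num_perimeter; set A := finset _; set B := finset _.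
have AP p : p \in A -> parts p \in [pred s | is_partition s && P s].
  by rewrite !inE => /and3P[-> _ ->].
(* The lists of underlying sequences are compared, so [f] need not be lifted to bounded
   sequences. *)
rewrite !cardE -(size_map (f \o @parts n)) -[leqRHS](size_map (@parts n)).
apply: uniq_leq_size.
  rewrite map_inj_in_uniq ?enum_uniq // => p q; rewrite !mem_enum => pA qA.
  by move=> /= /(f_inj _ _ (AP _ pA) (AP _ qA)); apply: parts_inj.
move=> x /mapP[p]; rewrite mem_enum => pA ->{x}.
have [part_f perim_f Qf] := fP _ (AP _ pA).
have perim_p : perimeter (parts p) = n by move: pA; rewrite inE => /and3P[_ /eqP].
have [q qE] := perimeter_bseq part_f (etrans perim_f perim_p).
apply/mapP; exists q; last by [].
by rewrite mem_enum inE qE part_f perim_f perim_p eqxx.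
Qed.

Lemma perimeter_cons x s :
  all (geq x) s -> perimeter (x :: s) = x + size s.
Proof.
move=> le_sx; rewrite /perimeter /= big_cons addnS subn1 /=.
suff /maxn_idPl -> : \max_(y <- s) y <= x by [].
by apply/bigmax_leqP_seq => y ys _; apply: (allP le_sx).
Qed.

Lemma pairwise_nseq (T : Type) (r : rel T) n x :
  r x x -> pairwise r (nseq n x).
Proof.
by move=> rxx; elim: n => //= n ->; rewrite all_nseq rxx orbT.
Qed.

Lemma geq_trans : transitive geq.
Proof. by move=> y x z /= yx zy; apply: leq_trans zy yx. Qed.

Section Injection.

Variables d a : nat.
Hypotheses (hd : 0 < d) (ha : 0 < a) (had : 2 * a < d + 3).

Definition pm_part j : nat :=
  if odd j then j./2.+1 * (d + 3) - a else j./2 * (d + 3) + a.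

(** The gaps are alternately [d + 3 - 2 * a] and [2 * a], positive by [had] and [ha]. *)
Lemma pm_part_ltS j : pm_part j < pm_part j.+1.
Proof.
rewrite /pm_part /= uphalf_half; move: (j./2) => k.
by case: (odd j) => /=; rewrite ?add1n ?add0n ?mulSn; lia.
Qed.

Lemma pm_part_inj : injective pm_part.
Proof. exact/incn_inj/leq_mono/(homo_ltn ltn_trans)/pm_part_ltS. Qed.

Lemma pm_part_gt0 j : 0 < pm_part j.
Proof. by rewrite /pm_part; case: (odd j); rewrite ?mulSn; lia. Qed.

(** The first gap is at most [d + 1] since [0 < a], and two successive gaps add up to [d + 3], at
    most [2 * (d + 1)] since [0 < d]. *)
Lemma pm_part_le j : pm_part j <= a + d.+1 * j.
Proof.
rewrite /pm_part; have := odd_double_half j; have := leq_pmulr j./2 hd.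
by move: (j./2) => k; case: (odd j) => /= le_k <-; rewrite -muln2; lia.
Qed.

Lemma pm_part_mod j :
  (pm_part j == a %[mod d + 3]) || (d + 3 %| pm_part j + a).
Proof.
rewrite /pm_part; case: (odd j); last by rewrite modnMDl eqxx.
by rewrite subnK ?dvdn_mull ?orbT // mulSn; lia.
Qed.

(** The least value allowed for a part put in front of [s]; the value [a] on the empty sequence lets
    the smallest part be treated like the others. *)
Definition floor_of (s : seq nat) : nat := if s is y :: _ then y + d else a.

Fixpoint slack_parts (s : seq nat) : seq nat :=
  if s is x :: s' then nseq (x - floor_of s') (pm_part (size s')) ++ slack_parts s'
  else [::].

(** Under this condition no subtraction in [slack_parts] is truncated. *)
Fixpoint floored (s : seq nat) : bool :=
  if s is x :: s' then (floor_of s' <= x) && floored s' else true.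

Lemma flooredP s : distinct_by d s -> parts_ge a s -> floored s.
Proof.
elim: s => //= x [|y s] IHs; first by rewrite /= !andbT.
by move=> /= /andP[-> ds] /andP[_ ge_as]; apply: IHs.
Qed.

Lemma slack_parts_lt s : all (fun y => y < pm_part (size s)) (slack_parts s).
Proof.
elim: s => //= x s IHs; rewrite all_cat all_nseq pm_part_ltS orbT /=.
by apply: sub_all IHs => y /ltn_trans; apply; apply: pm_part_ltS.
Qed.

Lemma all_slack_parts (P : pred nat) s :
  (forall j, P (pm_part j)) -> all P (slack_parts s).
Proof.
by move=> Ppm; elim: s => //= x s IHs; rewrite all_cat all_nseq Ppm orbT.
Qed.

(** Stated with [pairwise] because it splits over concatenation into conditions on the blocks and
    between them. *)
Lemma slack_parts_pairwise s : pairwise geq (slack_parts s).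
Proof.
elim: s => //= x s IHs; rewrite pairwise_cat IHs andbT pairwise_nseq /= ?andbT //.
apply/allrelP => y z /nseqP[-> _] /(allP (slack_parts_lt s)).
exact: ltnW.
Qed.

(** The slacks telescope to the largest part, minus [a] and one [d] per consecutive pair. *)
Lemma size_slack_parts x s :
  floored (x :: s) -> size (slack_parts (x :: s)) + a + d * size s = x.
Proof.
elim: s x => [|y s IHs] x; first by rewrite /= andbT cats0 size_nseq; lia.
rewrite [floored _]/= => /andP[le_x /IHs].
by rewrite [slack_parts (x :: _)]/= size_cat size_nseq /= in le_x *; lia.
Qed.

Lemma slack_parts_inj s t :
  floored s -> floored t -> size s = size t ->
  slack_parts s = slack_parts t -> s = t.
Proof.
elim: s t => [|x s IHs] [|y t] //= /andP[le_x fs] /andP[le_y ft] [eq_sz] eq_st.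
(* The tail only yields values below [pm_part (size s)], so the multiplicity of that value is
   exactly the first slack. *)
have notin u : size u = size s -> count_mem (pm_part (size s)) (slack_parts u) = 0.
  move=> szu; apply/count_memPn/negP => /(allP (slack_parts_lt u)).
  by rewrite szu ltnn.
have eq_c : x - floor_of s = y - floor_of t.
  have := congr1 (count_mem (pm_part (size s))) eq_st.
  by rewrite -eq_sz !count_cat !count_nseq /= eqxx !notin // !addn0 !mul1n.
move/eqP: eq_st; rewrite eq_c eq_sz eqseq_cat // eqxx => /eqP eq_st.
have eq_t : s = t by apply: IHs.
by congr (_ :: _) => //; move: eq_c le_x le_y; rewrite eq_t; lia.
Qed.

Definition pm_image (s : seq nat) : seq nat :=
  let j := (size s).-1 in
  pm_part j :: nseq (a + d.+1 * j - pm_part j) (pm_part j) ++ slack_parts s.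

(** The head determines the number of parts, hence the length of the padding block, which can then
    be stripped. *)
Lemma pm_image_inj s t :
  s != [::] -> t != [::] -> floored s -> floored t ->
  pm_image s = pm_image t -> s = t.
Proof.
case: s t => [|x s] [|y t] // _ _ fs ft.
rewrite /pm_image [size _]/= [size (y :: t)]/= !succnK => -[/pm_part_inj eq_sz].
rewrite eq_sz => /eqP; rewrite eqseq_cat // eqxx => /eqP eq_st.
by apply: slack_parts_inj => //=; rewrite eq_sz.
Qed.

Lemma pm_image_pairwise x s : pairwise geq (pm_image (x :: s)).
Proof.
have le_t : all (geq (pm_part (size s))) (slack_parts (x :: s)).
  rewrite /= all_cat all_nseq /= leqnn orbT /=.
  by apply: sub_all (slack_parts_lt s) => y /ltnW.
rewrite /pm_image [size _]/= succnK pairwise_cons all_cat le_t all_nseq andbT.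
apply/andP; split; first by rewrite /= leqnn orbT.
rewrite pairwise_cat slack_parts_pairwise pairwise_nseq /= ?leqnn // !andbT.
by apply/allrelP => y z /nseqP[-> _] /(allP le_t).
Qed.

Lemma perimeter_pm_image x s :
  floored (x :: s) -> perimeter (pm_image (x :: s)) = x + size s.
Proof.
move=> fs; have := pm_image_pairwise x s; rewrite /pm_image [size _]/= succnK.
move=> /andP[/perimeter_cons -> _]; rewrite size_cat size_nseq.
(* With [j = size s], the sum is [p j + (a + (d + 1) * j - p j) + (x - a - d * j) = x + j];
   [pm_part_le] makes the padding subtraction exact. *)
by have := size_slack_parts _ _ fs; have := pm_part_le (size s); lia.
Qed.

Lemma all_pm_image (P : pred nat) s :
  (forall j, P (pm_part j)) -> all P (pm_image s).
Proof.
by move=> Ppm; rewrite /= Ppm all_cat all_nseq Ppm orbT all_slack_parts.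
Qed.

Lemma is_partition_pm_image x s : is_partition (pm_image (x :: s)).
Proof.
rewrite /is_partition all_pm_image; last exact: pm_part_gt0.
by rewrite (sorted_pairwise geq_trans) pm_image_pairwise.
Qed.

End Injection.

Theorem theorem1p5 (d n a : nat)
  (hd : 0 < d) (hn : 0 < n) (ha : 0 < a) (had : 2 * a < d + 3) :
  h d a n <= l d a n.
Proof.
apply: (@num_perimeter_leq _ _ (pm_image d a)) => [s|s t]; rewrite !inE.
  case: s => // x s /andP[/and3P[_ _ s_sorted] /andP[ds ges]].
  have fs := flooredP _ _ _ ds ges.
  split; first exact: is_partition_pm_image.
    rewrite perimeter_pm_image // perimeter_cons //.
    by move: s_sorted; rewrite (sorted_pairwise geq_trans) => /andP[].
  by apply: all_pm_image => j; apply: pm_part_mod.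
move=> /andP[/and3P[s0 _ _] /andP[ds ges]] /andP[/and3P[t0 _ _] /andP[dt get]].
by apply: pm_image_inj => //; apply: flooredP.
Qed.
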